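(* Let $\mathcal{M}=(S,s_I,T,V,\mathcal{P})$ be a pMC, $R$ a graph-preserving region and $p\in V$. If $\mathrm{sol}_s$ is locally monotonic increasing in $p$ on $R$ for every state $s\in S$, then $\mathrm{sol}_{s_I}$ is monotonic increasing in $p$ on $R$.
   Context: A pMC is a tuple $\mathcal{M}=(S,s_I,T,V,\mathcal{P})$ with finite state set $S$, initial state $s_I$, target set $T\subseteq S$, finite parameter set $V$ and transition function $\mathcal{P}:S\times S\to\mathbb{Q}[V]$; $\mathrm{succ}(s)=\{s'\mid \mathcal{P}(s,s')\neq 0\}$. For an instantiation $\vec u:V\to\mathbb{R}$, $\mathcal{M}[\vec u]$ evaluates all polynomials at $\vec u$; $\vec u$ is graph-preserving if $\mathcal{M}[\vec u]$ is a Markov chain and $\mathcal{P}(s,s')\neq0$ implies $\mathcal{P}(s,s')(\vec u)\neq 0$. A region is a set of instantiations; it is graph-preserving if all its members are. $\mathrm{sol}_s(\vec u)$ is the probability of reaching $T$ from $s$ in $\mathcal{M}[\vec u]$. A function $f$ is monotonic increasing in $p$ on $R$ if $f(\vec a)\le f(\vec a+b\vec e_p)$ for all $\vec a\in R$, $b\ge 0$. $\mathrm{sol}_s$ is locally monotonic increasing in $p$ on $R$ if for all $\vec u\in R$: $\big(\sum_{s'\in\mathrm{succ}(s)} \frac{\partial}{\partial p}\mathcal{P}(s,s')\cdot \mathrm{sol}_{s'}\big)(\vec u)\ge 0$.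
   Formalization: ''Monotonic increasing in p on R'' is taken to compare sol at a and a + b·e_p only when the whole segment between them lies in R; without this the claim is ill-defined off R and false for non-convex R. For regions convex in direction p it just requires both end points in R. *)

(* Defs.v *)
From HB Require Import structures.
From mathcomp Require Import all_boot all_order all_algebra.
From mathcomp Require Import all_classical all_reals all_analysis.
From mathcomp Require mpoly.
Import (canonicals) mpoly.

Set Implicit Arguments.
Unset Strict Implicit.
Unset Printing Implicit Defensive.

Import Order.TTheory GRing.Theory Num.Theory.
Import numFieldNormedType.Exports.

Local Open Scope classical_set_scope.
Local Open Scope ring_scope.

(* The parameter set V is {0, ..., n - 1}. *)
Record pMC (n : nat) := PMC {
  state : finType ;
  init : state ;
  target : {set state} ;
  trans : state -> state -> mpoly.mpoly n rat }.

Definition succ (n : nat) (M : pMC n) (s : state M) : {set state M} :=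
  finset (fun s' => trans s s' != 0).

Definition instantiation (R : realType) (n : nat) := 'I_n -> R.

Definition eval (R : realType) (n : nat) (u : instantiation R n)
    (q : mpoly.mpoly n rat) : R :=
  mpoly.meval u (mpoly.map_mpoly (@ratr R) q).

Definition inst (R : realType) (n : nat) (M : pMC n) (u : instantiation R n)
    (s s' : state M) : R :=
  eval u (trans s s').

Definition markov_chain (R : realType) (S : finType) (K : S -> S -> R) : Prop :=
  (forall s s', 0 <= K s s') /\ (forall s, \sum_(s' : S) K s s' = 1).

Definition graph_preserving (R : realType) (n : nat) (M : pMC n)
    (u : instantiation R n) : Prop :=
  markov_chain (inst (M := M) u) /\
  forall s s' : state M, trans s s' != 0 -> inst u s s' != 0.

Definition graph_preserving_region (R : realType) (n : nat) (M : pMC n)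
    (D : set (instantiation R n)) : Prop :=
  forall u, D u -> graph_preserving M u.

(* Infinite paths, with the sigma-algebra generated by the cylinder sets. The
   choice of a default path is immaterial; the library requires one. *)
Definition ipath (n : nat) (M : pMC n) : Type := nat -> state M.

HB.instance Definition _ (n : nat) (M : pMC n) := gen_eqMixin (ipath M).
HB.instance Definition _ (n : nat) (M : pMC n) := gen_choiceMixin (ipath M).
HB.instance Definition _ (n : nat) (M : pMC n) :=
  isPointed.Build (ipath M) (fun=> init M).

Definition cylinder (n : nat) (M : pMC n) (w : seq (state M)) : set (ipath M) :=
  [set om | mkseq om (size w) = w].

Definition path_space (n : nat) (M : pMC n) :=
  g_sigma_algebraType (range (@cylinder n M)).

Fixpoint path_weight (R : realType) (S : finType) (K : S -> S -> R) (s : S)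
    (w : seq S) : R :=
  if w is t :: w' then K s t * path_weight K t w' else 1.

Definition is_path_measure (R : realType) (n : nat) (M : pMC n)
    (K : state M -> state M -> R) (s : state M)
    (mu : probability (path_space M) R) : Prop :=
  forall w, mu (cylinder (s :: w)) = (path_weight K s w)%:E.

(* The probability measure on paths starting in [s]; see [path_measureP]. *)
Definition path_measure (R : realType) (n : nat) (M : pMC n)
    (K : state M -> state M -> R) (s : state M) :
    probability (path_space M) R :=
  get [set mu : probability (path_space M) R | is_path_measure K s mu].

Definition reach (n : nat) (M : pMC n) (T : {set state M}) : set (ipath M) :=
  [set om | exists i, om i \in T].

Definition sol (R : realType) (n : nat) (M : pMC n) (s : state M)
    (u : instantiation R n) : R :=
  fine (path_measure (inst u) s (reach (target M))).

Definition shift_param (R : realType) (n : nat) (p : 'I_n) (b : R)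
    (a : instantiation R n) : instantiation R n :=
  fun q => a q + b * (q == p)%:R.

(* [D] is an arbitrary set, so the comparison of [a] with [a + b e_p] is made
   when the segment between them lies in [D]; for a [D] that is convex in
   direction [p] (e.g. a box) this only says that [a + b e_p] is in [D]. *)
Definition monotonic_increasing (R : realType) (n : nat)
    (f : instantiation R n -> R) (p : 'I_n) (D : set (instantiation R n)) :
    Prop :=
  forall (a : instantiation R n) (b : R), D a -> 0 <= b ->
    (forall c, 0 <= c <= b -> D (shift_param p c a)) ->
    f a <= f (shift_param p b a).

Definition locally_monotonic_increasing (R : realType) (n : nat) (M : pMC n)
    (s : state M) (p : 'I_n) (D : set (instantiation R n)) : Prop :=
  forall u, D u ->
    0 <= \sum_(s' in succ s) eval u (mpoly.mderiv p (trans s s')) * sol s' u.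

(* Existence of the path measure: it is the image of the Lebesgue measure on
   [0, 1[ by the inverse-distribution-function sampling of paths. *)
Section path_measure_existence.
Variables (R : realType) (n : nat) (M : pMC n) (K : state M -> state M -> R).
Hypothesis K_mc : markov_chain K.
Let S := state M.
Let K0 s s' : 0 <= K s s'. Proof. by case: K_mc. Qed.
Let K1 s : \sum_(s' : S) K s s' = 1. Proof. by case: K_mc. Qed.

Let Fixpoint sample (s : S) (l : seq S) (x : R) : S * R :=
  if l is t :: l' then
    if x < K s t then (t, x / K s t) else sample s l' (x - K s t)
  else (s, x).

Let step (y : S * R) := sample y.1 (index_enum S) y.2.

Let run (s : S) (x : R) : path_space M := fun i => (iter i step (s, x)).1.

Let sample_in s (l : seq S) x : 0 <= x < \sum_(i <- l) K s i ->
  (sample s l x).1 \in l /\ 0 <= (sample s l x).2 < 1.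
Proof.
elim: l x => [x|t l IH x] /=.
  by rewrite big_nil => /andP[x0 /(le_lt_trans x0)]; rewrite ltxx.
rewrite big_cons inE => /andP[x0 xS]; case: ifPn => [xK|].
  have k0 : 0 < K s t by apply: le_lt_trans xK.
  by rewrite /= eqxx divr_ge0// ltr_pdivrMr// mul1r.
rewrite -leNgt => Kx; have [|-> ->] := IH (x - K s t); last by rewrite orbT.
by rewrite subr_ge0 Kx ltrBlDl.
Qed.

Let sample_itv s (l : seq S) t a b : uniq l -> t \in l ->
  0 <= a -> a <= b -> b <= 1 ->
  exists c, [/\ 0 <= c, c + K s t <= \sum_(i <- l) K s i &
    forall x, 0 <= x < \sum_(i <- l) K s i ->
      ((sample s l x).1 = t /\ a <= (sample s l x).2 < b) <->
      c + a * K s t <= x < c + b * K s t].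
Proof.
elim: l => //= h l IH /andP[hl ul]; rewrite inE => tl a0 ab b1.
have S0 : 0 <= \sum_(i <- l) K s i by apply: sumr_ge0.
case: (eqVneq t h) tl => [-> _|th /= tl].
  exists 0; rewrite big_cons; split => //; first by rewrite add0r lerDl.
  move=> x /andP[x0 xS]; rewrite !add0r; case: ifPn => [xK|].
    have k0 : 0 < K s h by apply: le_lt_trans xK.
    by rewrite /= ler_pdivlMr// ltr_pdivrMr//; split => // -[].
  rewrite -leNgt => Kx; split=> [[E _]|/andP[_ xb]]; exfalso.
    have [|] := @sample_in s l (x - K s h); last by rewrite E (negbTE hl).
    by rewrite subr_ge0 Kx ltrBlDl.
  move: xb; apply/negP; rewrite -leNgt.
  by apply: le_trans Kx; rewrite ler_piMl.
have [c [c0 cS Hc]] := IH ul tl a0 ab b1.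
exists (K s h + c); rewrite big_cons; split; first exact: addr_ge0.
  by rewrite -addrA lerD2l.
move=> x /andP[x0 xS]; rewrite -!addrA; case: ifPn => [xK|].
  split=> [[E]|/andP[H _]]; first by rewrite -E eqxx in th.
  exfalso; move: xK; apply/negP; rewrite -leNgt; apply: le_trans H.
  by rewrite lerDl addr_ge0// mulr_ge0.
rewrite -leNgt => Kx; rewrite -lerBrDl -ltrBlDl; apply: Hc.
by rewrite subr_ge0 Kx ltrBlDl.
Qed.

Let runS s x i : run s x i.+1 = run (step (s, x)).1 (step (s, x)).2 i.
Proof. by rewrite /run iterSr -surjective_pairing. Qed.

Let run_cylinder s x s' t (w : seq S) :
  cylinder (s' :: t :: w) (run s x) <->
  [/\ s = s', (step (s, x)).1 = t &
      cylinder (t :: w) (run (step (s, x)).1 (step (s, x)).2)].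
Proof.
have E m : mkseq (run s x) m.+1 =
    s :: mkseq (run (step (s, x)).1 (step (s, x)).2) m.
  rewrite {1}/mkseq [iota _ _]/= map_cons -[1%N]/(1 + 0)%N iotaDl -map_comp.
  by congr cons; apply: eq_map => i; rewrite /comp add1n runS.
rewrite /cylinder /= E; split=> [[-> <- H]|[-> _ ->//]].
by split => //; congr cons.
Qed.

Let run_itv (w : seq S) s : exists a b, [/\ 0 <= a, a <= b, b <= 1,
  b - a = path_weight K s w &
  forall x, 0 <= x < 1 -> cylinder (s :: w) (run s x) <-> a <= x < b].
Proof.
elim: w s => [|t w IH] s.
  by exists 0, 1; split => //; rewrite subr0.
have [a [b [a0 ab b1 abE H]]] := IH t.
have [|c [c0 cS Hc]] := @sample_itv s (index_enum S) t a b
  (index_enum_uniq S) _ a0 ab b1; first by rewrite mem_index_enum.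
have S1 : \sum_(i <- index_enum S) K s i = 1 by exact: K1.
exists (c + a * K s t), (c + b * K s t); split.
- by rewrite addr_ge0// mulr_ge0.
- by rewrite lerD2l ler_wpM2r.
- by rewrite -S1 (le_trans _ cS)// lerD2l ler_piMl.
- by rewrite /= -abE opprD addrACA subrr add0r -mulrBl mulrC.
move=> x x01; rewrite -Hc ?S1// -/(step (s, x)).
have [|_ x'01] := @sample_in s (index_enum S) x; first by rewrite S1.
rewrite run_cylinder; split=> [[_ E]|[E xab]].
  by rewrite E => /(H _ x'01).
by split => //; rewrite E; apply/(H _ x'01).
Qed.

Let I01 : set R := `[0, 1[%classic.

Let cylinder_itv (w : seq S) s : exists a b,
  I01 `&` run s @^-1` cylinder w = `[a, b[%classic.
Proof.
case: w => [|t w]; first by exists 0, 1; apply/seteqP; split=> [x []|x].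
case: (eqVneq t s) => [->|ts].
  have [a [b [a0 ab b1 _ H]]] := run_itv w s.
  exists a, b; apply/seteqP; split=> [x|x] /=.
    by rewrite /I01 /= !in_itv /= => -[x01 /(H _ x01)].
  rewrite /I01 /= !in_itv /= => xab.
  have x01 : 0 <= x < 1.
    by case/andP: xab => ax xb; rewrite (le_trans a0 ax) (lt_le_trans xb b1).
  by split => //; apply/H.
exists 0, 0; apply/seteqP; split=> [x [_ /=]|x] /=.
  by rewrite /cylinder /= /mkseq /= /run /= => -[E]; rewrite E eqxx in ts.
by rewrite in_itv /= => /andP[] /le_lt_trans /[apply]; rewrite ltxx.
Qed.

Let measurable_run s : measurable_fun I01 (run s).
Proof.
apply: (@measurability _ _ _ (path_space M) I01 (run s)
  (range (@cylinder n M))) => //.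
move=> _ [_ [w _ <-] <-].
by have [a [b ->]] := cylinder_itv w s; exact: measurable_itv.
Qed.

Variable s : S.

Definition sampling_measure (A : set (path_space M)) : \bar R :=
  lebesgue_measure (I01 `&` run s @^-1` A).

Let nu0 : sampling_measure set0 = 0%E.
Proof. by rewrite /sampling_measure preimage_set0 setI0 measure0. Qed.

Let nu_ge0 A : (0 <= sampling_measure A)%E. Proof. exact: measure_ge0. Qed.

Let nu_sigma_additive : semi_sigma_additive sampling_measure.
Proof.
move=> F mF tF mUF; rewrite /sampling_measure preimage_bigcup setI_bigcupr.
apply: measure_semi_sigma_additive.
- by move=> i; apply: measurable_run => //; exact: measurable_itv.
- apply/trivIsetP => /= i j _ _ ij; rewrite setIACA setIid -preimage_setI.
  by move/trivIsetP : tF => /(_ _ _ _ _ ij) ->//; rewrite preimage_set0 setI0.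
- rewrite -setI_bigcupr -preimage_bigcup; apply: measurable_run => //.
  exact: measurable_itv.
Qed.

HB.instance Definition _ := isMeasure.Build _ _ _ sampling_measure nu0 nu_ge0
  nu_sigma_additive.

Let nuT : sampling_measure setT = 1%E.
Proof.
rewrite /sampling_measure preimage_setT setIT.
by rewrite lebesgue_measure_itv /= lte_fin ltr01 oppr0 adde0.
Qed.

HB.instance Definition _ := Measure_isProbability.Build _ _ _
  sampling_measure nuT.

Lemma path_measureP : is_path_measure K s (path_measure K s).
Proof.
apply: (@getPex _ [set mu : probability (path_space M) R |
  is_path_measure K s mu]).
exists (sampling_measure : probability _ _) => w; rewrite /= /sampling_measure.
have [a [b [a0 ab b1 abE H]]] := run_itv w s.
rewrite (_ : _ `&` _ = `[a, b[%classic).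
  rewrite lebesgue_measure_itv /= lte_fin -abE.
  by move: ab; rewrite le_eqVlt => /orP[/eqP->|->//]; rewrite ltxx subrr.
apply/seteqP; split=> [x|x] /=.
  by rewrite /I01 /= !in_itv /= => -[x01 /(H _ x01)].
rewrite /I01 /= !in_itv /= => xab.
have x01 : 0 <= x < 1.
  by case/andP: xab => ax xb; rewrite (le_trans a0 ax) (lt_le_trans xb b1).
by split => //; apply/H.
Qed.

End path_measure_existence.

(* Main.v *)
(** Differentiability of [sol] is not needed. Fix a segment [u c], [0 <= c <=
    b], in direction [p], with transition matrices [K c] and reachability
    probabilities [x c]. On the non-target states from which the target can be
    reached, [x d - x c = K d (x d - x c) + (K d - K c) x c], and this
    difference vanishes on all other states. A first-order Taylor expansion
    and local monotonicity give [(K d - K c) x c >= - C (d - c)^2]. On the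
    compact segment the non-zero transition probabilities are bounded away
    from 0, so a single drift function works for all [K d], and the minimum
    principle yields [x d - x c >= - C' (d - c)^2] with [C'] independent of
    [c] and [d]. Subdividing the segment makes the total loss arbitrarily
    small. *)

Require Import Defs.
From mathcomp Require Import all_boot all_order all_algebra.
From mathcomp Require Import all_classical all_reals all_analysis.
From mathcomp Require Import ring lra.
From mathcomp Require mpoly.
Import (canonicals) mpoly.

Set Implicit Arguments.
Unset Strict Implicit.
Unset Printing Implicit Defensive.

Import Order.TTheory GRing.Theory Num.Theory.
Import numFieldNormedType.Exports.

Local Open Scope classical_set_scope.
Local Open Scope ring_scope.

(** * Tools on finite chains and real functions: drift, minimum principle, quadratic loss *)

Fixpoint reachable_within (S : finType) (e : rel S) (T : {set S}) (k : nat)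
    (s : S) : bool :=
  (s \in T) ||
  (if k is j.+1 then [exists t, e s t && reachable_within e T j t] else false).

Fixpoint hit_within (R : realType) (S : finType) (K : S -> S -> R)
    (T : {set S}) (k : nat) (s : S) : R :=
  if s \in T then 1
  else if k is j.+1 then \sum_t K s t * hit_within K T j t else 0.

Section drift.
Variables (R : realType) (S : finType) (e : rel S) (T : {set S}) (delta : R).
Hypothesis delta01 : 0 < delta <= 1.

Let reachable s := exists k, reachable_within e T k s.

(** States that cannot reach [T] get the default 0, so the drift function built from [dist] takes
    its maximal value [alpha] there. *)
Let dist s : nat :=
  if pselect (reachable s) is left r then ex_minn r else 0%N.

Let distP s : s \notin T -> reachable s ->
  exists2 t, e s t & (dist t < dist s)%N.
Proof.
move=> sT rs; rewrite {2}/dist; case: pselect => // r.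
case: ex_minnP => -[|k]; first by rewrite /= orbF (negbTE sT).
rewrite /= (negbTE sT) /= => /existsP[t /andP[est rt]] _.
exists t => //; rewrite ltnS /dist; case: pselect => // rt'.
by case: ex_minnP => m _; apply.
Qed.

(* With [g s = alpha * (delta / 2) ^ dist s], where [dist] is the graph distance
   to [T], the single transition that decreases [dist] already at least doubles
   [g]; [alpha] is chosen so that the gain is at least [2]. *)
Lemma exists_drift_function : exists (g : S -> R) (alpha : R),
  (forall s, 0 <= g s <= alpha) /\
  forall K, markov_chain K -> (forall s t, e s t -> delta <= K s t) ->
  forall s, s \notin T -> reachable s -> g s + 2 <= \sum_t K s t * g t.
Proof.
have [d0 d1] := andP delta01.
pose eps := delta / 2; pose N := \max_s dist s.
have e0 : 0 < eps by rewrite divr_gt0.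
have e1 : eps <= 1 by rewrite /eps; lra.
pose alpha := 2 / eps ^+ N.
have a0 : 0 < alpha by rewrite divr_gt0// exprn_gt0.
have g0 s : 0 < alpha * eps ^+ dist s by rewrite mulr_gt0 ?exprn_gt0.
exists (fun s => alpha * eps ^+ dist s), alpha; split.
  by move=> s; rewrite ltW//= ler_piMr ?(ltW a0)// exprn_ile1// ltW.
move=> K [K0 _] Ke s sT rs; have [t est dts] := distP sT rs.
rewrite (bigD1 t)//= -[leLHS]addr0; apply: lerD; last first.
  by apply: sumr_ge0 => i _; rewrite mulr_ge0// ltW.
(* Doubling [g s] adds at least 2 once [g s >= 2]; this holds for [alpha = 2 / eps ^+ N] because
   [dist s <= N]. *)
have g2 : 2 <= alpha * eps ^+ dist s.
  rewrite /alpha mulrAC -mulrA ler_pMr// ler_pdivlMr ?exprn_gt0// mul1r.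
  by apply: ler_wiXn2l => //; [exact: ltW|exact: leq_bigmax].
apply: (@le_trans _ _ (delta * (alpha * eps ^+ dist t))); last first.
  by apply: ler_wpM2r; [exact: ltW|exact: Ke].
have -> : delta * (alpha * eps ^+ dist t) = 2 * (alpha * eps ^+ (dist t).+1).
  by rewrite exprS /eps; field.
suff : alpha * eps ^+ dist s <= alpha * eps ^+ (dist t).+1 by lra.
by rewrite ler_pM2l//; apply: ler_wiXn2l => //; exact: ltW.
Qed.

End drift.

(** Minimum principle for [z = y + eta * (alpha - g)]. A minimiser [m] with [z m < 0] satisfies [Q],
    since [y] vanishes elsewhere. Minimality gives [z m <= \sum_t K m t * z t], but this average is
    at most [z m - eta]: averaging raises [y] by at most [eta] and [g] by at least 2. *)
Lemma comparison_lower_bound (R : realType) (S : finType) (K : S -> S -> R)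
    (Q : S -> Prop) (g : S -> R) (alpha eta : R) (y : S -> R) :
  markov_chain K -> 0 < eta -> (forall s, 0 <= g s <= alpha) ->
  (forall s, Q s -> g s + 2 <= \sum_t K s t * g t) ->
  (forall s, ~ Q s -> y s = 0) ->
  (forall s, Q s -> \sum_t K s t * y t - eta <= y s) ->
  forall s, - (eta * alpha) <= y s.
Proof.
move=> [K0 K1] eta0 ga gQ ynQ yQ s.
pose z t := y t + eta * (alpha - g t).
suff z0 : 0 <= z s.
  have [gs0 _] := andP (ga s).
  have : 0 <= eta * g s by rewrite mulr_ge0// ltW.
  by move: z0; rewrite /z; lra.
have [m _ zm] := @arg_minP _ _ S s predT z isT.
apply: le_trans (zm s isT); rewrite leNgt; apply/negP => zm0.
have [Qm|nQm] := pselect (Q m); last first.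
  move: zm0; rewrite /z ynQ// add0r ltNge mulr_ge0 ?(ltW eta0)//.
  by rewrite subr_ge0; case/andP: (ga m).
have Kz : \sum_t K m t * z t =
    \sum_t K m t * y t + eta * (alpha - \sum_t K m t * g t).
  rewrite -[alpha in RHS]mulr1 -(K1 m) mulr_sumr -sumrB mulr_sumr -big_split /=.
  by apply: eq_bigr => t _; rewrite /z; ring.
have zle : z m <= \sum_t K m t * z t.
  rewrite -[leLHS]mul1r -(K1 m) mulr_suml; apply: ler_sum => t _.
  by rewrite ler_wpM2l// zm.
have := yQ _ Qm.
have : eta * (g m + 2) <= eta * \sum_t K m t * g t by rewrite ler_pM2l// gQ.
by move: zle; rewrite Kz /z; lra.
Qed.

Lemma hit_within_unreachable (R : realType) (S : finType) (e : rel S)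
    (K : S -> S -> R) (T : {set S}) (k : nat) (s : S) :
  (forall s t, ~~ e s t -> K s t = 0) ->
  ~~ reachable_within e T k s -> hit_within K T k s = 0.
Proof.
move=> Ke; elim: k s => [|k IH] s /=; first by rewrite orbF => /negbTE ->.
rewrite negb_or => /andP[/negbTE -> /existsPn H]; apply: big1 => t _.
have [est|/Ke ->] := boolP (e s t); last by rewrite mul0r.
by rewrite IH ?mulr0//; move: (H t); rewrite est.
Qed.

(* Halving [[c, d]] [k] times improves the constant to [C / 2 ^ k]. *)
Lemma nondecreasing_of_quadratic_loss (R : realType) (f : R -> R) (b C : R) :
  (forall c d, 0 <= c -> c <= d -> d <= b -> f c - C * (d - c) ^+ 2 <= f d) ->
  0 <= b -> f 0 <= f b.
Proof.
move=> H b0.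
have Hk k c d : 0 <= c -> c <= d -> d <= b ->
    f c - C / 2 ^+ k * (d - c) ^+ 2 <= f d.
  elim: k c d => [|k IH] c d c0 cd db; first by rewrite expr0 divr1; exact: H.
  have h1 := IH c ((c + d) / 2) ltac:(lra) ltac:(lra) ltac:(lra).
  have h2 := IH ((c + d) / 2) d ltac:(lra) ltac:(lra) ltac:(lra).
  have e1 : (c + d) / 2 - c = (d - c) / 2 by field.
  have e2 : d - (c + d) / 2 = (d - c) / 2 by field.
  have -> : C / 2 ^+ k.+1 * (d - c) ^+ 2 =
      C / 2 ^+ k * ((d - c) / 2) ^+ 2 + C / 2 ^+ k * ((d - c) / 2) ^+ 2.
    by rewrite exprS; field; rewrite expf_neq0.
  by move: h1 h2; rewrite e1 e2; lra.
(* The loss on [[0, b]] is a geometric sequence in [k], so the inequality passes to the limit. *)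
have cv : (fun k => f 0 - C * (b - 0) ^+ 2 * (1 / 2) ^+ k) @ \oo -->
    f 0.
  rewrite -[X in _ --> X]subr0.
  apply: cvgB; first exact: cvg_cst.
  by apply: (cvg_geometric (C * (b - 0) ^+ 2)); rewrite ger0_norm; lra.
apply: (@cvgr_to_le _ _ _ _ _ _ _ cv); apply: nearW => k.
have := Hk k 0 b (lexx _) b0 (lexx _).
suff -> : C / 2 ^+ k * (b - 0) ^+ 2 = C * (b - 0) ^+ 2 * (1 / 2) ^+ k by [].
by rewrite expr_div_n expr1n; field; rewrite expf_neq0.
Qed.

(** * Hitting probabilities under the path measure *)

Lemma path_weight_rcons (R : realType) (S : finType) (K : S -> S -> R) (s : S)
    (w : seq S) (t : S) :
  path_weight K s (rcons w t) = path_weight K s w * K (last s w) t.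
Proof.
elim: w s => [|h w IH] s /=; first by rewrite mulr1 mul1r.
by rewrite IH mulrA.
Qed.

Section reachability.
Variables (R : realType) (n : nat) (M : pMC n) (K : state M -> state M -> R).
Hypothesis K_mc : markov_chain K.
Let S := state M.
Variable T : {set S}.

Let X := path_space M.

Lemma cylinder_measurable (w : seq S) : measurable (cylinder w : set X).
Proof. by apply: sub_gen_smallest; exists w. Qed.

Lemma cylinder_rcons (w : seq S) (t : S) (om : ipath M) :
  cylinder (rcons w t) om <-> cylinder w om /\ om (size w) = t.
Proof.
rewrite /cylinder /= size_rcons mkseqS; split=> [/rcons_inj[-> ->]//|].
by move=> [-> ->].
Qed.

Lemma cylinder_last (s : S) (w : seq S) (om : ipath M) :
  cylinder (s :: w) om -> om (size w) = last s w.
Proof. by rewrite lastI => /cylinder_rcons[_]; rewrite size_belast. Qed.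

(** Time is counted from the end of the prefix: position [size w] holds the last state of [s :: w],
    so [i = 0] tests that state itself. *)
Let hit_after (s : S) (w : seq S) (k : nat) : set X :=
  [set om | cylinder (s :: w) om /\
            exists2 i, (i <= k)%N & om (size w + i)%N \in T].

Let hit_afterS s w k : last s w \notin T ->
  hit_after s w k.+1 =
  \bigcup_(t in [set` index_enum S]) hit_after s (rcons w t) k.
Proof.
move=> lT; apply/seteqP; split=> om /=.
  move=> [cw [[|i] ik omi]].
    by move: omi lT; rewrite addn0 (cylinder_last cw) => ->.
  exists (om (size w).+1); first by rewrite /= mem_index_enum.
  split; last by exists i => //; rewrite size_rcons addSnnS.
  by rewrite -rcons_cons; apply/cylinder_rcons.
move=> [t _ [+ [i ik omi]]]; rewrite -rcons_cons => /cylinder_rcons[cw _].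
split=> //; exists i.+1 => //; by rewrite size_rcons addSnnS in omi.
Qed.

Let hit_after0 s w : last s w \notin T -> hit_after s w 0 = set0.
Proof.
move=> lT; apply/seteqP; split=> om //= -[cw [[|//] _ omi]].
by move: omi lT; rewrite addn0 (cylinder_last cw) => ->.
Qed.

Let hit_afterT s w k : last s w \in T -> hit_after s w k = cylinder (s :: w).
Proof.
move=> lT; apply/seteqP; split=> om /=; first by case.
by move=> cw; split=> //; exists 0%N => //; rewrite addn0 (cylinder_last cw).
Qed.

Let hit_after_measurable s w k : measurable (hit_after s w k).
Proof.
elim: k w => [|k IH] w.
  have [lT|lT] := boolP (last s w \in T).
    by rewrite hit_afterT//; exact: cylinder_measurable.
  by rewrite hit_after0.
have [lT|lT] := boolP (last s w \in T).
  by rewrite hit_afterT//; exact: cylinder_measurable.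
rewrite hit_afterS//; apply: fin_bigcup_measurable => //; exact: finite_seq.
Qed.

(** The path measure is known only on cylinders from the fixed start [s], so the induction on [k]
    lets the prefix [w] grow at its end; splitting by the next state then replaces an appeal to the
    Markov property. *)
Let hit_after_measure s w k : path_measure K s (hit_after s w k) =
  (path_weight K s w * hit_within K T k (last s w))%:E.
Proof.
elim: k w => [|k IH] w /=; case: ifPn => lT.
- by rewrite hit_afterT// path_measureP// mulr1.
- by rewrite hit_after0// measure0 mulr0.
- by rewrite hit_afterT// path_measureP// mulr1.
rewrite hit_afterS// measure_fin_bigcup; last 3 first.
- exact: finite_seq.
- apply/trivIsetP => t t' _ _ tt'; apply/seteqP; split=> om //=.
  move=> [[+ _] [+ _]]; rewrite -!rcons_cons.
  move=> /cylinder_rcons[_ E] /cylinder_rcons[_ E'].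
  by rewrite -E -E' eqxx in tt'.
- by move=> t _; exact: hit_after_measurable.
rewrite -(@fsbig_seq _ _ _ _ _ _ (index_enum_uniq S)) mulr_sumr -sumEFin.
apply: eq_bigr => t _; rewrite [LHS]IH path_weight_rcons last_rcons.
by rewrite mulrA.
Qed.

Let reach_cylinder s :
  reach T `&` cylinder [:: s] = \bigcup_k hit_after s [::] k.
Proof.
apply/seteqP; split=> om /=.
  by move=> [[i omi] cs]; exists i => //; split => //; exists i.
by move=> [k _ [cs [i _ omi]]]; split => //; exists i.
Qed.

Lemma reach_measurable : measurable (reach T : set X).
Proof.
have -> : reach T = \bigcup_(s in [set` index_enum S])
    \bigcup_k hit_after s [::] k :> set X.
  apply/seteqP; split=> om /=.
    move=> omT; exists (om 0%N); first by rewrite /= mem_index_enum.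
    by rewrite -reach_cylinder.
  by move=> [s _]; rewrite -reach_cylinder => -[].
apply: fin_bigcup_measurable => [|s _]; first exact: finite_seq.
exact: bigcupT_measurable.
Qed.

(** Paths that do not start in [s] form a null set, because the cylinder of [[:: s]] has measure
    1. *)
Let path_measure_reach s :
  path_measure K s (reach T) = path_measure K s (\bigcup_k hit_after s [::] k).
Proof.
have mc := cylinder_measurable [:: s].
rewrite -reach_cylinder (measureDI _ reach_measurable mc).
rewrite [X in (X + _)%E](_ : _ = 0)%E ?add0e//.
apply: (@subset_measure0 _ X R (path_measure K s) _ (~` cylinder [:: s])).
- exact: measurableD reach_measurable mc.
- exact: measurableC.
- by move=> om [].
- rewrite [LHS]probability_setC//.
  by have /= -> := path_measureP K_mc s [::]; rewrite subee.
Qed.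

(** Continuity of the measure from below along the increasing events [hit_after s [::] k]. *)
Lemma hit_within_cvg s :
  hit_within K T k s @[k --> \oo] --> fine (path_measure K s (reach T)).
Proof.
have mU : measurable (\bigcup_k hit_after s [::] k) by
  exact: bigcupT_measurable.
have nd : {homo hit_after s [::] : k m / (k <= m)%N >-> (k <= m)%O}.
  move=> k m km; apply/subsetPset => om [cs [i ik omi]]; split => //.
  by exists i => //; exact: leq_trans km.
have := @nondecreasing_cvg_mu _ _ _ (path_measure K s) _
  (hit_after_measurable s [::]) mU nd.
rewrite [X in _ --> X](_ : _ = (fine (path_measure K s (reach T)))%:E);
  last first.
  rewrite -[LHS]path_measure_reach fineK//.
  by apply: fin_num_measure; exact: reach_measurable.
move=> /fine_cvgP[_].
suff -> : fine \o (path_measure K s \o hit_after s [::]) =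
  (fun k => hit_within K T k s) by [].
by apply/funext => k /=; rewrite hit_after_measure /= mul1r.
Qed.

End reachability.

(** * Equations for the reachability probabilities *)

Section sol_equations.
Variables (R : realType) (n : nat) (M : pMC n) (u : instantiation R n).
Hypothesis u_mc : markov_chain (inst (M := M) u).
Implicit Types s : state M.

Lemma sol_ge0_le1 s : 0 <= sol s u <= 1.
Proof.
rewrite /sol fine_ge0//= -lee_fin fineK ?probability_le1//.
  exact: reach_measurable.
by apply: fin_num_measure; exact: reach_measurable.
Qed.

Lemma sol_target s : s \in target M -> sol s u = 1.
Proof.
move=> sT; have cv := @hit_within_cvg _ _ _ _ u_mc (target M) s.
apply: (cvg_unique _ cv) => //.
suff -> : (fun k => hit_within (inst u) (target M) k s) = fun=> 1.
  exact: cvg_cst.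
by apply/funext => -[|k] /=; rewrite sT.
Qed.

(** The recursion of [hit_within], shifted by one index, passes to the limit through the finite
    sum. *)
Lemma sol_step s : s \notin target M ->
  sol s u = \sum_t inst u s t * sol t u.
Proof.
move=> sT; have := @hit_within_cvg _ _ _ _ u_mc (target M) s.
rewrite -cvg_shiftS /= (negbTE sT) => cv; apply: (cvg_unique _ cv) => //.
apply: cvg_big => [|t _]; first exact: add_continuous.
by apply: cvgMl_tmp; exact: hit_within_cvg.
Qed.

Lemma sol_unreachable s :
  ~ (exists k, reachable_within (fun s t => trans s t != 0) (target M) k s) ->
  sol s u = 0.
Proof.
move=> ns; have cv := @hit_within_cvg _ _ _ _ u_mc (target M) s.
apply: (cvg_unique _ cv) => //.
suff -> : (fun k => hit_within (inst u) (target M) k s) = fun=> 0.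
  exact: cvg_cst.
apply/funext => k.
apply: (@hit_within_unreachable _ _ (fun s t => trans s t != 0)).
  move=> s' t; rewrite negbK /inst /Defs.eval => /eqP ->.
  by rewrite raddf0 mpoly.meval0.
by apply/negP => r; apply: ns; exists k.
Qed.

End sol_equations.

(** * Polynomials along a segment in direction [p] *)

(** The polynomials with this property contain the constants and the variables and are closed under
    sums and products (Leibniz rule), hence are all polynomials. *)
Lemma horner_mpoly_line (R : realType) (n : nat) (a : instantiation R n)
    (p : 'I_n) (P : mpoly.mpoly n rat) :
  exists q : {poly R}, forall c : R,
    q.[c] = Defs.eval (shift_param p c a) P /\
    q^`().[c] = Defs.eval (shift_param p c a) (mpoly.mderiv p P).
Proof.
pose good P := exists q : {poly R}, forall c : R,
    q.[c] = Defs.eval (shift_param p c a) P /\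
    q^`().[c] = Defs.eval (shift_param p c a) (mpoly.mderiv p P).
have evD u (A B : mpoly.mpoly n rat) :
    Defs.eval u (A + B) = Defs.eval u A + Defs.eval u B :> R.
  by rewrite /Defs.eval raddfD mpoly.mevalD.
have evM u (A B : mpoly.mpoly n rat) :
    Defs.eval u (A * B) = Defs.eval u A * Defs.eval u B :> R.
  by rewrite /Defs.eval rmorphM mpoly.mevalM.
have evC u c : Defs.eval u (mpoly.mpolyC n c) = ratr c :> R.
  by rewrite /Defs.eval mpoly.map_mpolyC mpoly.mevalC.
have ev0 u : Defs.eval u (0 : mpoly.mpoly n rat) = 0 :> R.
  by rewrite /Defs.eval raddf0 mpoly.meval0.
have goodC c : good (mpoly.mpolyC n c).
  exists (ratr c)%:P => d.
  by rewrite hornerC derivC horner0 mpoly.mderivC evC ev0.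
have goodD A B : good A -> good B -> good (A + B).
  move=> [q Hq] [r Hr]; exists (q + r) => c; rewrite derivD !hornerD.
  have [-> ->] := Hq c; have [-> ->] := Hr c.
  by rewrite mpoly.mderivD !evD.
have goodM A B : good A -> good B -> good (A * B).
  move=> [q Hq] [r Hr]; exists (q * r) => c; rewrite derivM hornerD !hornerM.
  have [-> ->] := Hq c; have [-> ->] := Hr c.
  by rewrite mpoly.mderivM !evD !evM.
have goodX i : good (mpoly.mpolyX _ (mpoly.mnm1 i)).
  exists ((a i)%:P + (i == p)%:R *: 'X) => c.
  rewrite !hornerE derivD derivC derivZ derivX add0r hornerZ hornerC mulr1.
  rewrite /Defs.eval mpoly.map_mpolyX mpoly.mevalXU /shift_param mulrC.
  split => //.
  rewrite mpoly.mderivX mpoly.mnm1E; have [->|ip] := eqVneq i p.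
    rewrite scale1r (_ : mpoly.mnm_sub _ _ = mpoly.mnm0).
      rewrite mpoly.mpolyX0 -mpoly.mpolyC1. 
      by rewrite mpoly.map_mpolyC mpoly.mevalC; exact/esym/rmorph1.
    by apply/mpoly.mnmP => j; rewrite mpoly.mnmBE mpoly.mnm0E subnn.
  by rewrite [_ *: _]scale0r; exact/esym/ev0.
elim/mpoly.mpolyind : P => [|c m P _ _ IH].
  by rewrite -mpoly.mpolyC0; exact: goodC.
apply: (goodD) => //; rewrite -mpoly.mul_mpolyC; apply: (goodM) => //.
rewrite mpoly.mpolyXE_id; apply: (big_ind good) => //.
  by rewrite -mpoly.mpolyC1; exact: goodC.
move=> i _; elim: (mpoly.fun_of_multinom m i) => [|k IHk].
  by rewrite expr0 -mpoly.mpolyC1; exact: goodC.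
by rewrite exprS; exact: goodM.
Qed.

Lemma horner_itv_bounded (R : realType) (b : R) (q : {poly R}) :
  exists2 C, 0 <= C & forall c, 0 <= c <= b -> `|q.[c]| <= C.
Proof.
have [b0|b0] := leP 0 b; last first.
  exists 0 => // c /andP[c0 cb].
  by have := le_lt_trans (le_trans c0 cb) b0; rewrite ltxx.
elim/poly_ind : q => [|q k [C C0 H]].
  by exists 0 => // c _; rewrite horner0 normr0.
exists (C * b + `|k|); first by rewrite addr_ge0// mulr_ge0.
move=> c cb; rewrite !hornerE; apply: le_trans (ler_normD _ _) _.
rewrite lerD2r normrM; apply: ler_pM => //; first exact: H.
by case/andP: cb => c0 cb; rewrite ger0_norm.
Qed.

Lemma horner_itv_taylor1 (R : realType) (b : R) (q : {poly R}) :
  exists2 C, 0 <= C & forall c d, 0 <= c <= b -> 0 <= d <= b ->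
    `|q.[d] - q.[c] - (d - c) * q^`().[c]| <= C * (d - c) ^+ 2.
Proof.
have [b0|b0] := leP 0 b; last first.
  exists 0 => // c d /andP[c0 cb].
  by have := le_lt_trans (le_trans c0 cb) b0; rewrite ltxx.
elim/poly_ind : q => [|q k [C C0 H]].
  by exists 0 => // c d _ _; rewrite deriv0 !horner0 mulr0 !subr0 normr0 mul0r.
have [B B0 HB] := horner_itv_bounded b q^`().
exists (b * C + B); first by rewrite addr_ge0// mulr_ge0.
move=> c d cb db; rewrite derivD derivM derivX derivC addr0 mulr1.
rewrite !(hornerD, hornerM, hornerX, hornerC).
rewrite (_ : _ - _ - _ = d * (q.[d] - q.[c] - (d - c) * q^`().[c]) +
  (d - c) ^+ 2 * q^`().[c]); last by ring.
apply: le_trans (ler_normD _ _) _; rewrite [leRHS]mulrDl; apply: lerD.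
  rewrite normrM -mulrA; apply: ler_pM => //; last exact: H.
  by case/andP: db => d0 db; rewrite ger0_norm.
rewrite normrM (ger0_norm (sqr_ge0 _)) mulrC.
apply: ler_wpM2r; first exact: sqr_ge0.
exact: HB.
Qed.

Lemma horner_itv_gt0_bounded_away (R : realType) (b : R) (q : {poly R}) :
  0 <= b -> (forall c, 0 <= c <= b -> 0 < q.[c]) ->
  exists2 delta, 0 < delta & forall c, 0 <= c <= b -> delta <= q.[c].
Proof.
move=> b0 q0.
have [c cb Hc] := EVT_min b0 (continuous_subspaceT (@continuous_horner _ q)).
exists q.[c]; first by apply: q0; rewrite in_itv in cb.
by move=> t tb; apply: Hc; rewrite in_itv.
Qed.

(** * Quadratic loss of the reachability probabilities along the segment *)

Theorem theorem2 (R : realType) (n : nat) (M : pMC n)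
    (D : set (instantiation R n)) (p : 'I_n)
    (D_gp : graph_preserving_region M D)
    (D_loc : forall s : state M, locally_monotonic_increasing s p D) :
  monotonic_increasing (sol (init M)) p D.
Proof.
move=> a b Da b0 Dc.
pose u c := shift_param p c a.
have u0 : u 0 = a by apply/funext => q; rewrite /u /shift_param mul0r addr0.
rewrite -{1}u0 -/(u b).
have mc c : 0 <= c <= b -> markov_chain (inst (M := M) (u c)).
  by move=> /Dc /D_gp[].
pose e := [rel s t : state M | trans s t != 0].
have /choice[q qE] (st : state M * state M) : exists q : {poly R}, forall c,
    q.[c] = inst (u c) st.1 st.2 /\
    q^`().[c] = Defs.eval (u c) (mpoly.mderiv p (trans st.1 st.2)).
  exact: horner_mpoly_line.
have /choice[dl dlP] (st : state M * state M) : exists dl, 0 < dl /\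
    (e st.1 st.2 -> forall c, 0 <= c <= b -> dl <= inst (u c) st.1 st.2).
  (* Non-edges get the value 1, which leaves a minimum capped at 1 unchanged. *)
  have [est|nest] := boolP (e st.1 st.2); last by exists 1.
  have [|dl dl0 H] := @horner_itv_gt0_bounded_away R b (q st) b0.
    move=> c cb; have [-> _] := qE st c; have [[K0 _] Kn] := D_gp _ (Dc _ cb).
    by rewrite lt_def K0 andbT; exact: Kn.
  by exists dl; split => // _ c cb; have [<- _] := qE st c; exact: H.
have /choice[ta taP] (st : state M * state M) : exists ta, 0 <= ta /\
    forall c d, 0 <= c <= b -> 0 <= d <= b ->
      `|inst (u d) st.1 st.2 - inst (u c) st.1 st.2 -
        (d - c) * Defs.eval (u c) (mpoly.mderiv p (trans st.1 st.2))|
      <= ta * (d - c) ^+ 2.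
  have [ta ta0 H] := horner_itv_taylor1 b (q st).
  exists ta; split => // c d cb db; have := H _ _ cb db.
  by have [-> _] := qE st d; have [-> ->] := qE st c.
(* One bound for all edges and all points of the segment, so that [g] and [alpha] depend on neither
   [c] nor [d]. *)
pose delta := \big[Num.min/1]_st dl st.
have delta01 : 0 < delta <= 1.
  rewrite bigmin_le_id andbT.
  apply: (big_ind (fun x => 0 < x)) => // [x y x0 y0|st _].
    by rewrite lt_min x0.
  by have [] := dlP st.
have [g [alpha [ga gP]]] := exists_drift_function e (target M) delta01.
(* The sum over all pairs dominates every row sum of [ta]; the summand 1 makes [C] positive. *)
pose C := 1 + \sum_st ta st.
have C0 : 0 < C.
  by rewrite ltr_pwDl// sumr_ge0// => st _; have [] := taP st.
apply: (@nondecreasing_of_quadratic_loss R (fun c => sol (init M) (u c)) b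
  (C * alpha)) => // c d c0 cd db.
have cb : 0 <= c <= b by rewrite c0 (le_trans cd).
have db' : 0 <= d <= b by rewrite (le_trans c0).
(* The comparison needs [eta = C * (d - c) ^+ 2] to be strictly positive, so [c = d] is treated
   apart. *)
have [->|ncd] := eqVneq c d; first by rewrite subrr expr0n mulr0 subr0.
have dc0 : 0 < d - c by rewrite subr_gt0 lt_neqAle ncd.
pose Q s := s \notin target M /\
  exists k, reachable_within e (target M) k s.
suff : - (C * (d - c) ^+ 2 * alpha) <= sol (init M) (u d) - sol (init M) (u c).
  by rewrite mulrAC; lra.
apply: (@comparison_lower_bound _ _ (inst (u d)) Q g alpha (C * (d - c) ^+ 2)
  (fun s => sol s (u d) - sol s (u c))) => //.
- exact: mc.
- by rewrite mulr_gt0 ?exprn_gt0.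
- move=> s [sT rs]; apply: gP => //; first exact: mc.
  move=> s' t est; have [_ H] := dlP (s', t).
  apply: le_trans (H est d db'); exact: bigmin_le_cond.
(* Outside [Q] both probabilities are 1 (target) or both are 0 (target unreachable). *)
- move=> s nQ; have [sT|sT] := boolP (s \in target M).
    by rewrite !sol_target ?subrr//; exact: mc.
  rewrite !sol_unreachable ?subrr//; try exact: mc.
    by move=> rs; apply: nQ.
  by move=> rs; apply: nQ.
move=> s [sT _].
rewrite [in leRHS](sol_step (mc d db') sT) [in leRHS](sol_step (mc c cb) sT).
(* Local monotonicity at [u c]; the sum over [succ s] extends to all [t] because the zero polynomial
   has zero derivative. *)
have loc : 0 <= \sum_t (d - c) *
    (Defs.eval (u c) (mpoly.mderiv p (trans s t)) * sol t (u c)).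
  rewrite -mulr_sumr mulr_ge0// ?(ltW dc0)//.
  have := D_loc s _ (Dc _ cb); rewrite big_mkcond /=.
  congr (_ <= _); apply: eq_bigr => t _; rewrite inE; case: ifPn => //.
  rewrite negbK => /eqP ->.
  by rewrite mpoly.mderiv0 /Defs.eval raddf0 mpoly.meval0 mul0r.
(* The Taylor remainders are weighted by probabilities in [[0, 1]], so their absolute bounds
   survive. *)
have rem : - (C * (d - c) ^+ 2) <= \sum_t (inst (u d) s t - inst (u c) s t -
    (d - c) * Defs.eval (u c) (mpoly.mderiv p (trans s t))) * sol t (u c).
  apply: (@le_trans _ _ (\sum_t - (ta (s, t) * (d - c) ^+ 2))).
    rewrite sumrN lerN2 -mulr_suml; apply: ler_wpM2r; first exact: sqr_ge0.
    rewrite /C (_ : \sum_st ta st = \sum_s' \sum_t ta (s', t)).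
      rewrite [X in 1 + X](bigD1 s)//= addrCA lerDl addr_ge0//.
      rewrite sumr_ge0// => s' _.
      by rewrite sumr_ge0// => t _; have [] := taP (s', t).
    by rewrite pair_big; apply: eq_bigr => -[].
  apply: ler_sum => t _; have [ta0 /(_ c d cb db') /= H] := taP (s, t).
  have /andP[s0 s1] := sol_ge0_le1 (u c) t.
  apply: lerNnormlW; rewrite normrM.
  by apply: le_trans H; rewrite ler_piMr// ger0_norm.
(* Insert the mixed term [inst (u d) s t * sol t (u c)] and the first-order term; [rem] and [loc]
   bound the last two sums. *)
suff -> : \sum_t inst (u d) s t * sol t (u d) -
    \sum_t inst (u c) s t * sol t (u c) =
  \sum_t inst (u d) s t * (sol t (u d) - sol t (u c)) +
  \sum_t (inst (u d) s t - inst (u c) s t -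
    (d - c) * Defs.eval (u c) (mpoly.mderiv p (trans s t))) * sol t (u c) +
  \sum_t (d - c) *
    (Defs.eval (u c) (mpoly.mderiv p (trans s t)) * sol t (u c)) by lra.
by rewrite -sumrB -!big_split /=; apply: eq_bigr => t _; ring.
Qed.
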